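(* Let $(\rho,\mathbf u,\mathbf B)$ be a (smooth, $\rho>0$) solution on $\mathbb R^+\times\mathbb R^2$ of $$\begin{cases}\partial_t\rho+\mathrm{div}(\rho\mathbf u)=0,\\ \partial_t(\rho\mathbf u)+\mathrm{div}(\rho\mathbf u\otimes\mathbf u-\mathbf B\otimes\mathbf B)+\nabla\left(P(\rho)+\tfrac12|\mathbf B|^2\right)=\mu\Delta\mathbf u+(\lambda+\mu)\nabla\mathrm{div}\,\mathbf u,\\ \partial_t\mathbf B-\nabla\times(\mathbf u\times\mathbf B)=0,\quad \mathrm{div}\,\mathbf B=0,\end{cases}$$ with initial values $\rho_0,\mathbf u_0,\mathbf B_0$, and let the $2\times2$ matrix field $\mathtt F$ (with positive determinant) satisfy $\partial_t\mathtt F+\mathbf u\cdot\nabla\mathtt F=\nabla\mathbf u\,\mathtt F$. Put $A=\mathtt F^{-1}$ and $A_0=A|_{t=0}$. Then, along the flow map of $\mathbf u$, $$\rho^{-1}A\mathbf B(t)=\rho_0^{-1}A_0\mathbf B_0\quad\text{for all }t\ge0,$$ i.e. $(\rho^{-1}A\mathbf B)(t,x(t,y))=(\rho_0^{-1}A_0\mathbf B_0)(y)$ for all $t\ge0$ and $y\in\mathbb R^2$, where $\frac{d}{dt}x(t,y)=\mathbf u(t,x(t,y))$, $x(0,y)=y$.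
   Context: Two-dimensional setting: $\rho$ is scalar, $\mathbf u,\mathbf B$ are $\mathbb R^2$-valued, $(\nabla\mathbf u)_{ij}=\partial_{x_j}\mathbf u_i$, and $\nabla\times(\mathbf u\times\mathbf B)=\mathbf B\cdot\nabla\mathbf u-\mathbf u\cdot\nabla\mathbf B-\mathbf B\,\mathrm{div}\,\mathbf u+\mathbf u\,\mathrm{div}\,\mathbf B$. The constants satisfy $\mu>0$, $\mu+\lambda\ge0$, and $P(\rho)=\frac13\rho^3$. *)

(* Defs.v *)
From HB Require Import structures.
From mathcomp Require Import all_boot all_order all_algebra.
From mathcomp Require Import all_classical all_reals all_analysis.

Set Implicit Arguments.
Unset Strict Implicit.
Unset Printing Implicit Defensive.

Import Order.TTheory GRing.Theory Num.Theory.
Import numFieldNormedType.Exports.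

Local Open Scope classical_set_scope.
Local Open Scope ring_scope.

(* Functions of class C^k on the open set U. When V is finite dimensional,
   continuity (resp. C^k regularity) of all the directional derivatives amounts
   to that of the Frechet differential. *)
Fixpoint class_C (R : realType) (V W : normedModType R) (k : nat)
    (U : set V) (f : V -> W) : Prop :=
  match k with
  | 0 => forall p, U p -> {for p, continuous f}
  | k'.+1 => (forall p, U p -> differentiable f p) /\
             (forall v : V, class_C k' U (fun p => 'D_v f p))
  end.

Section SpaceTime.
Context {R : realType}.

(* Points of R^2, and vectors, are columns. Beware that the library norm on
   matrices is the sup norm. *)
Local Notation plane := 'cV[R]_2.

(* Time-dependent fields f t x are total in t, but only their values for
   0 <= t are meaningful: they are of class C^k for t > 0, and continuous up to
   t = 0, where they take their initial value. *)
Definition class_C_evolution (W : normedModType R) (k : nat)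
    (f : R -> plane -> W) : Prop :=
  class_C k [set p : R * plane | 0 < p.1] (fun p => f p.1 p.2) /\
  {within [set p : R * plane | 0 <= p.1], continuous (fun p => f p.1 p.2)}.

Definition smooth_evolution (W : normedModType R) (f : R -> plane -> W) : Prop :=
  forall k, class_C_evolution k f.

Definition dt (W : normedModType R) (f : R -> plane -> W) (t : R) (x : plane)
  : W := derive1 (fun s => f s x) t.

Definition dx (W : normedModType R) (j : 'I_2) (f : plane -> W) (x : plane)
  : W := 'D_(delta_mx j 0) f x.

Definition grad (f : plane -> R) (x : plane) : plane := \col_i dx i f x.

Definition div (v : plane -> plane) (x : plane) : R :=
  \sum_j dx j (fun y => v y j 0) x.

(* Divergence of a tensor field, taken row by row. *)
Definition divT (T : plane -> 'M[R]_2) (x : plane) : plane :=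
  \col_i \sum_j dx j (fun y => T y i j) x.

Definition nabla (v : plane -> plane) (x : plane) : 'M[R]_2 :=
  \matrix_(i, j) dx j (fun y => v y i 0) x.

Definition laplacian (v : plane -> plane) (x : plane) : plane :=
  \sum_j dx j (dx j v) x.

(* The transport term v . nabla f. *)
Definition advect (W : normedModType R) (v : plane -> plane) (f : plane -> W)
    (x : plane) : W := \sum_j v x j 0 *: dx j f x.

Definition tensor (a b : plane) : 'M[R]_2 := a *m b^T.

Definition sqnorm (a : plane) : R := \sum_i a i 0 ^+ 2.

Definition curl_cross (u B : plane -> plane) (x : plane) : plane :=
  advect B u x - advect u B x - div u x *: B x + div B x *: u x.

Definition pressure (r : R) : R := 3^-1 * r ^+ 3.

Record mhd_solution (mu lambda : R) (rho : R -> plane -> R)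
    (u B : R -> plane -> plane) (rho0 : plane -> R) (u0 B0 : plane -> plane)
    : Prop := MhdSolution {
  mhd_smooth_rho : smooth_evolution rho ;
  mhd_smooth_u : smooth_evolution u ;
  mhd_smooth_B : smooth_evolution B ;
  mhd_rho_gt0 : forall (t : R) x, 0 <= t -> 0 < rho t x ;
  mhd_continuity : forall (t : R) x, 0 < t ->
    dt rho t x + div (fun y => rho t y *: u t y) x = 0 ;
  mhd_momentum : forall (t : R) x, 0 < t ->
    dt (fun s y => rho s y *: u s y) t x
    + divT (fun y => rho t y *: tensor (u t y) (u t y)
                     - tensor (B t y) (B t y)) x
    + grad (fun y => pressure (rho t y) + 2^-1 * sqnorm (B t y)) x
    = mu *: laplacian (u t) x + (lambda + mu) *: grad (div (u t)) x ;
  mhd_induction : forall (t : R) x, 0 < t ->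
    dt B t x - curl_cross (u t) (B t) x = 0 ;
  mhd_div_free : forall (t : R) x, 0 < t -> div (B t) x = 0 ;
  mhd_init_rho : forall x, rho 0 x = rho0 x ;
  mhd_init_u : forall x, u 0 x = u0 x ;
  mhd_init_B : forall x, B 0 x = B0 x
}.

Record deformation_field (u : R -> plane -> plane) (F : R -> plane -> 'M[R]_2)
    : Prop := DeformationField {
  deformation_C1 : class_C_evolution 1 F ;
  deformation_det_gt0 : forall (t : R) x, 0 <= t -> 0 < \det (F t x) ;
  deformation_eq : forall (t : R) x, 0 < t ->
    dt F t x + advect (u t) (F t) x = nabla (u t) x *m F t x
}.

(* Continuity at t = 0 together with the equation for t > 0 gives the equation
   at t = 0 with a right derivative, since u is continuous up to t = 0. *)
Record flow_map (u : R -> plane -> plane) (X : R -> plane -> plane) : Prop :=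
  FlowMap {
  flow_init : forall y, X 0 y = y ;
  flow_continuous : forall y,
    {within [set t : R | 0 <= t], continuous (fun t => X t y)} ;
  flow_ode : forall (t : R) y, 0 < t ->
    is_derive t 1 (fun s => X s y) (u t (X t y))
}.

End SpaceTime.

(* Main.v *)
(** The density, the magnetic field and the deformation gradient, read along a
    trajectory of [u], satisfy r' = - tr(N) r, b' = N b - tr(N) b and G' = N G,
    where N is the velocity gradient. Hence r det(G) and adj(G) b both have zero
    derivative, and r^-1 G^-1 b is their quotient (r det(G))^-1 adj(G) b. *)

Require Import Defs.
From HB Require Import structures.
From mathcomp Require Import all_boot all_order all_algebra.
From mathcomp Require Import all_classical all_reals all_analysis.
From mathcomp Require Import ring.
Import Order.TTheory GRing.Theory Num.Theory.
Import numFieldNormedType.Exports.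
Local Open Scope ring_scope.

Local Open Scope classical_set_scope.

Set Implicit Arguments.
Unset Strict Implicit.

(** * Two-by-two matrices and curves of matrices, entry by entry *)

Lemma sum_ord2 (V : nmodType) (F : 'I_2 -> V) : \sum_i F i = F 0 + F 1.
Proof.
by rewrite big_ord_recl big_ord1; congr (_ + F _); apply: val_inj.
Qed.

Lemma ord2P (i : 'I_2) : i = 0 \/ i = 1.
Proof. by case: i => [[|[|[]]]] // ?; [left|right]; apply: val_inj. Qed.

Lemma det_mx22 (R : comPzRingType) (M : 'M[R]_2) :
  \det M = M 0 0 * M 1 1 - M 0 1 * M 1 0.
Proof.
rewrite (expand_det_row _ 0) sum_ord2 /cofactor !det_mx11 !mxE /=.
rewrite expr0 expr1 mul1r mulN1r mulrN.
by congr (_ * M _ _ - _ * M _ _); apply: val_inj.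
Qed.

Lemma adj_mulmx22 (R : comPzRingType) (M : 'M[R]_2) (v : 'cV[R]_2) i :
  (\adj M *m v) i 0 = if i == 0 then M 1 1 * v 0 0 - M 0 1 * v 1 0
                      else M 0 0 * v 1 0 - M 1 0 * v 0 0.
Proof.
rewrite mxE sum_ord2 !mxE /cofactor !det_mx11 !mxE.
have [->|->] := ord2P i; rewrite /= ?expr0 ?expr1 ?expr2 ?mulN1r ?opprK ?mul1r.
- by rewrite mulNr; congr (M _ _ * _ - M _ _ * _); apply: val_inj.
- by rewrite mulNr addrC; congr (M _ _ * _ - M _ _ * _); apply: val_inj.
Qed.

Lemma within_continuous_mx_coord (T : topologicalType) (R : realType)
    (m n : nat) (S : set T) (M : T -> 'M[R]_(m, n)) i j :
  {within S, continuous M} -> {within S, continuous (fun s => M s i j)}.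
Proof.
move=> cM s; apply: (@continuous_comp (subspace S) _ _ M
  (fun N : 'M[R]_(m, n) => N i j)); first exact: cM.
exact: coord_continuous.
Qed.

Lemma is_derive_mx_coord (R : realType) (m n : nat) (M : R -> 'M[R]_(m, n))
    (t : R) (D : 'M[R]_(m, n)) i j :
  is_derive t 1 M D -> is_derive t 1 (fun s => M s i j) (D i j).
Proof.
move=> [dM DM]; split; first by move: dM => /derivable_mxP; exact.
by rewrite -DM derive_mx // mxE.
Qed.

(** * Calculus along a trajectory: chain rule, continuity up to the initial time, and the transport
    operators *)

Section TransportAlongFlow.
Context {R : realType}.
Local Notation plane := 'cV[R]_2.
Implicit Types (X : R -> plane) (t : R) (x v : plane).

(** Chain rule for [s |-> f s (X s)]: joint differentiability in time and space allows composition
    with the curve [s |-> (s, X s)], and both partial derivatives are values of the same joint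
    differential. *)
Lemma is_derive_along (W : normedModType R) (f : R -> plane -> W) X t v :
  differentiable (fun p : R * plane => f p.1 p.2) (t, X t) ->
  is_derive t 1 X v ->
  is_derive t 1 (fun s => f s (X s))
    (dt f t (X t) + \sum_j v j 0 *: dx j (f t) (X t)).
Proof.
set f' := fun p => _; set x := X t => df [dX DX].
have dX' : differentiable X t by exact/derivable1_diffP.
have dtE : dt f t x = 'd f' (t, x) (1, 0).
  have ? : is_diff t (fun s : R => (s, x)) (fun h => (h, 0)).
    exact: is_diff_pair.
  rewrite /dt derive1E -[fun s => _]/(f' \o fun s => (s, x)) deriveE.
    by rewrite diff_comp //= diff_val.
  exact: differentiable_comp.
have dxE j : dx j (f t) x = 'd f' (t, x) (0, delta_mx j 0).
  have ? : is_diff x (fun y : plane => (t, y)) (fun h => (0, h)).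
    exact: is_diff_pair.
  rewrite /dx -[f t]/(f' \o fun y => (t, y)) deriveE.
    by rewrite diff_comp //= diff_val.
  exact: differentiable_comp.
have ? : is_diff t (fun s => (s, X s)) (fun h => (h, 'd X t h)).
  exact: is_diff_pair.
have dcomp : differentiable (f' \o fun s => (s, X s)) t.
  exact: differentiable_comp.
rewrite -[fun s => f s _]/(f' \o fun s => (s, X s)).
split; first exact/derivable1_diffP.
rewrite deriveE // diff_comp //= diff_val -(deriveE (1 : R) dX') DX dtE.
under eq_bigr do rewrite dxE -linearZ.
rewrite -linear_sum -linearD; congr ('d _ _ _).
(* By linearity of the differential, it remains to decompose the velocity of the curve: [(1, v)] is
   [(1, 0)] plus the combination of the [(0, delta_mx j 0)] with coefficients [v j 0]. *)
apply/pair_equal_spec; split => /=.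
  by rewrite raddf_sum big1 ?addr0 // => j _; exact: mulr0.
rewrite raddf_sum add0r [LHS]matrix_sum_delta; apply: eq_bigr => j _.
by rewrite big_ord1.
Qed.

Lemma continuous_along (W : normedModType R) (f : R -> plane -> W) X :
  {within [set p : R * plane | 0 <= p.1], continuous (fun p => f p.1 p.2)} ->
  {within [set t : R | 0 <= t], continuous X} ->
  {within [set t : R | 0 <= t], continuous (fun t => f t (X t))}.
Proof.
move=> /subspace_continuousP cf /subspace_continuousP cX.
apply/subspace_continuousP => t t0; set S := [set t : R | 0 <= t].
have cid : s @[s --> within S (nbhs t)] --> t by exact: cvg_within.
have cp := cvg_pair cid (cX t t0).
apply: (cvg_comp (fun s => (s, X s)) _ _ (cf (t, X t) t0)) => P /cp nP.
(* One premise [S s] is the time domain of the curve; the other is the half-space condition on the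
   point [(s, X s)], which is again [0 <= s]. *)
have {}nP : \forall s \near t, S s -> S s -> P (s, X s) by exact: nP.
suff : \forall s \near t, S s -> P (s, X s) by [].
by apply: filterS nP => s sP s0; exact: sP.
Qed.

(** Mean value theorem on the segment from 0 to [t]: the derivative is taken only at interior times,
    and continuity up to 0 carries the conclusion to the initial value. *)
Lemma is_derive0_cst (f : R -> R) (t : R) :
  {within [set s : R | 0 <= s], continuous f} ->
  (forall s : R, 0 < s -> is_derive s 1 f 0) -> 0 <= t -> f t = f 0.
Proof.
move=> cf df t0; apply/eqP; rewrite -subr_eq0; apply/eqP.
have [s||c _ ->] := @MVT_segment R f (fun=> 0) 0 t t0; last by rewrite mul0r.
- by rewrite in_itv /= => /andP[? _]; exact: df.
- apply: continuous_subspaceW cf => s /=.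
  by rewrite in_itv /= => /andP[].
Qed.

Lemma differentiable_slice (W : normedModType R) (f : R -> plane -> W) t x :
  differentiable (fun p : R * plane => f p.1 p.2) (t, x) ->
  differentiable (f t) x.
Proof.
move=> df; rewrite -[f t]/((fun p : R * plane => f p.1 p.2) \o fun y => (t, y)).
exact: differentiable_comp.
Qed.

Lemma advectE (m n : nat) (w : plane -> plane) (f : plane -> 'M[R]_(m, n)) x i j :
  differentiable f x -> advect w f x i j = \sum_k w x k 0 * dx k (fun y => f y i j) x.
Proof.
move=> df; rewrite /advect summxE; apply: eq_bigr => k _.
by rewrite mxE /dx derive_mx ?mxE //; exact: diff_derivable.
Qed.

(** Turns the stretching term of the induction equation into the velocity gradient acting on the
    magnetic field. *)
Lemma advect_nabla (w u : plane -> plane) x :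
  differentiable u x -> advect w u x = nabla u x *m w x.
Proof.
move=> du; apply/matrixP => i j; rewrite ord1 advectE // mxE.
by apply: eq_bigr => k _; rewrite mxE mulrC.
Qed.

Lemma div_trace (u : plane -> plane) x : div u x = \tr (nabla u x).
Proof. by apply: eq_bigr => j _; rewrite mxE. Qed.

(** Splits the mass flux, so that the continuity equation exhibits the material derivative of the
    density. *)
Lemma div_scale (r : plane -> R) (u : plane -> plane) x :
  differentiable r x -> differentiable u x ->
  div (fun y => r y *: u y) x = advect u r x + r x * div u x.
Proof.
move=> dr du; rewrite /div /advect mulr_sumr -big_split /=.
apply: eq_bigr => j _; rewrite /dx.
have duj : differentiable (fun y => u y j 0) x.
  exact: (differentiable_comp du (differentiable_coord (u x) j 0)).
under eq_fun do rewrite mxE.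
rewrite [LHS](@deriveM _ _ r (fun y => u y j 0)); last 2 first.
- exact: diff_derivable.
- exact: diff_derivable.
by rewrite addrC.
Qed.

End TransportAlongFlow.

(** * The two quantities conserved along a trajectory *)

Section Conservation.
Context {R : realType}.
Local Notation plane := 'cV[R]_2.
Context (rho : R -> R) (b : R -> plane) (G : R -> 'M[R]_2).

(** By Liouville's formula the determinant grows at rate [\tr N], which compensates the decay of
    [rho] at the same rate. *)
Lemma is_derive_det_scale (t : R) (N : 'M[R]_2) :
  is_derive t 1 rho (- \tr N * rho t) -> is_derive t 1 G (N *m G t) ->
  is_derive t 1 (fun s => rho s * \det (G s)) 0.
Proof.
move=> drho dG; have dGij i j := is_derive_mx_coord i j dG.
(* Algebra on functions, rather than pointwise, lets the sum and product rules for [is_derive] be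
   found by instance inference. *)
have -> : (fun s => rho s * \det (G s)) =
    rho * ((fun s => G s 0 0) * (fun s => G s 1 1)
           - (fun s => G s 0 1) * (fun s => G s 1 0)).
  by apply/funext => s; rewrite det_mx22.
apply: is_derive_eq; rewrite !fctE !mxE /mxtrace !sum_ord2 /GRing.scale /=.
ring.
Qed.

(** The derivative of [\adj G] is [\tr N *: \adj G - \adj G *m N]; applied to [b], its two terms
    cancel those coming from [b']. The check is made on entries, which are bilinear in [G] and [b]
    in dimension two. *)
Lemma is_derive_adj_mul (t : R) i (N : 'M[R]_2) :
  is_derive t 1 b (N *m b t - \tr N *: b t) ->
  is_derive t 1 G (N *m G t) ->
  is_derive t 1 (fun s => (\adj (G s) *m b s) i 0) 0.
Proof.
move=> db dG; have dGij k l := is_derive_mx_coord k l dG.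
have dbi k := is_derive_mx_coord k 0 db.
under eq_fun do rewrite adj_mulmx22.
case: (i == 0).
- apply: (is_derive_eq (f := (fun s => G s 1 1) * (fun s => b s 0 0)
                      - (fun s => G s 0 1) * (fun s => b s 1 0))).
  rewrite !mxE /mxtrace !sum_ord2 /GRing.scale /=; ring.
- apply: (is_derive_eq (f := (fun s => G s 0 0) * (fun s => b s 1 0)
                      - (fun s => G s 1 0) * (fun s => b s 0 0))).
  rewrite !mxE /mxtrace !sum_ord2 /GRing.scale /=; ring.
Qed.

Context (S : set R).

Lemma within_continuous_det_scale :
  {within S, continuous rho} -> {within S, continuous G} ->
  {within S, continuous (fun s => rho s * \det (G s))}.
Proof.
move=> crho cG.
have cGij i j : {within S, continuous (fun s => G s i j)}.
  exact: within_continuous_mx_coord.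
under eq_fun do rewrite det_mx22.
move=> s; apply: cvgM (crho s) _.
by apply: cvgB; apply: cvgM; exact: cGij.
Qed.

Lemma within_continuous_adj_mul i :
  {within S, continuous b} -> {within S, continuous G} ->
  {within S, continuous (fun s => (\adj (G s) *m b s) i 0)}.
Proof.
move=> cb cG.
have cGij k l : {within S, continuous (fun s => G s k l)}.
  exact: within_continuous_mx_coord.
have cbi k : {within S, continuous (fun s => b s k 0)}.
  exact: within_continuous_mx_coord.
under eq_fun do rewrite adj_mulmx22.
by case: (i == 0) => s; apply: cvgB; apply: cvgM;
  (exact: cGij || exact: cbi).
Qed.

End Conservation.

Unset Implicit Arguments.

Theorem proposition2p1 (R : realType) (mu lambda : R)
  (hmu : 0 < mu) (hlambda : 0 <= mu + lambda)
  (rho : R -> 'cV[R]_2 -> R) (u B : R -> 'cV[R]_2 -> 'cV[R]_2)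
  (rho0 : 'cV[R]_2 -> R) (u0 B0 : 'cV[R]_2 -> 'cV[R]_2)
  (hsol : mhd_solution mu lambda rho u B rho0 u0 B0)
  (F : R -> 'cV[R]_2 -> 'M[R]_2) (hF : deformation_field u F)
  (A : R -> 'cV[R]_2 -> 'M[R]_2) (hA : forall t x, A t x = invmx (F t x))
  (A0 : 'cV[R]_2 -> 'M[R]_2) (hA0 : forall x, A0 x = A 0 x)
  (X : R -> 'cV[R]_2 -> 'cV[R]_2) (hX : flow_map u X) :
  forall (t : R) (y : 'cV[R]_2), 0 <= t ->
    (rho t (X t y))^-1 *: (A t (X t y) *m B t (X t y))
    = (rho0 y)^-1 *: (A0 y *m B0 y).
Proof.
move=> t y t0.
pose r s := rho s (X s y); pose b s := B s (X s y); pose G s := F s (X s y).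
pose N s := nabla (u s) (X s y).
have dX (s : R) : 0 < s -> is_derive s 1 (fun s => X s y) (u s (X s y)).
  exact: flow_ode hX s y.
have dr (s : R) : 0 < s -> is_derive s 1 r (- \tr (N s) * r s).
  move=> s0; have drho := (mhd_smooth_rho hsol 1%N).1.1 (s, X s y) s0.
  have du := (mhd_smooth_u hsol 1%N).1.1 (s, X s y) s0.
  apply: is_derive_eq (is_derive_along drho (dX s s0)) _.
  move: (mhd_continuity hsol (X s y) s0).
  rewrite div_scale; try exact: differentiable_slice.
  (* In the expanded continuity equation the first two terms form the material derivative of the
     density; the third moves to the right-hand side. *)
  rewrite div_trace /advect /= => /eqP; rewrite addrA addr_eq0 => /eqP ->.
  by rewrite mulNr mulrC.
have dG (s : R) : 0 < s -> is_derive s 1 G (N s *m G s).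
  move=> s0; have dF := (deformation_C1 hF).1.1 (s, X s y) s0.
  have := is_derive_along dF (dX s s0).
  by rewrite -/(advect (u s) (F s) (X s y)) (deformation_eq hF).
have db (s : R) : 0 < s -> is_derive s 1 b (N s *m b s - \tr (N s) *: b s).
  move=> s0; have dB := (mhd_smooth_B hsol 1%N).1.1 (s, X s y) s0.
  have du := (mhd_smooth_u hsol 1%N).1.1 (s, X s y) s0.
  apply: is_derive_eq (is_derive_along dB (dX s s0)) _.
  move: (mhd_induction hsol (X s y) s0) => /eqP; rewrite subr_eq0 => /eqP ->.
  (* The solenoidal condition removes the last term, and the advection of [B] cancels against the
     convective part of the material derivative. *)
  rewrite /curl_cross (mhd_div_free hsol) // scale0r addr0 div_trace.
  rewrite advect_nabla; last exact: differentiable_slice du.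
  by rewrite /advect addrAC subrK.
have cX : {within [set s : R | 0 <= s], continuous (fun s => X s y)}.
  exact: flow_continuous hX y.
(* The evolution equations hold at positive times only; continuity up to 0 links the conserved
   quantities to the initial data. *)
have cr : {within [set s : R | 0 <= s], continuous r}.
  exact: (continuous_along (mhd_smooth_rho hsol 0%N).2 cX).
have cb : {within [set s : R | 0 <= s], continuous b}.
  exact: continuous_along (mhd_smooth_B hsol 0%N).2 cX.
have cG : {within [set s : R | 0 <= s], continuous G}.
  exact: continuous_along (deformation_C1 hF).2 cX.
have detE : r t * \det (G t) = r 0 * \det (G 0).
  apply: (is_derive0_cst (f := fun s => r s * \det (G s))) => // [|s s0].
    exact: within_continuous_det_scale cr cG.
  exact: is_derive_det_scale (dr s s0) (dG s s0).
have adjE : \adj (G t) *m b t = \adj (G 0) *m b 0.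
  apply/matrixP => i j; rewrite ord1.
  apply: (is_derive0_cst (f := fun s => (\adj (G s) *m b s) i 0)) => // [|s s0].
    exact: within_continuous_adj_mul cb cG.
  exact: is_derive_adj_mul (db s s0) (dG s s0).
have wE (s : R) : 0 <= s -> (r s)^-1 *: (invmx (G s) *m b s) =
    (r s * \det (G s))^-1 *: (\adj (G s) *m b s).
  move=> s0; have detG := deformation_det_gt0 hF (X s y) s0.
  (* A positive determinant selects the branch of [invmx] that is the adjugate divided by the
     determinant. *)
  by rewrite /invmx unitmxE unitfE gt_eqF // -scalemxAl scalerA invfM.
have X0 := flow_init hX y.
rewrite hA0 !hA -(mhd_init_rho hsol) -(mhd_init_B hsol).
rewrite -[rho t _]/(r t) -[F t _]/(G t) -[B t _]/(b t) wE // detE adjE.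
by rewrite -wE // /r /G /b X0.
Qed.
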